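(* Let $U_8^{31}=\{L(C)\in TLeib_8 : c_{3,4}=0,\ c_{2,3}=c_{2,4}=c_{1,2}=0,\ c_{1,3}\neq 0,\ c_{1,4}\neq 0\}$. 1. Two algebras $L(C)$ and $L(C')$ from $U_8^{31}$ are isomorphic if and only if the following three equalities hold: $$\frac{{c'}_{1,3}^{4}\left(-9c'_{0,0}{c'}_{1,3}^{4}+3c'_{1,5}c'_{0,1}{c'}_{1,3}^{2}-{c'}_{1,5}^{2}c'_{1,1}\right)}{{c'}_{1,4}^{7}}=\frac{c_{1,3}^4\left(-9c_{0,0}c_{1,3}^4+3c_{1,5}c_{0,1}c_{1,3}^2-c_{1,5}^2c_{1,1}\right)}{c_{1,4}^7},$$ $$\frac{{c'}_{1,3}^{3}\left(-2c'_{1,5}c'_{1,1}+3c'_{0,1}{c'}_{1,3}^{2}\right)}{{c'}_{1,4}^{5}}=\frac{c_{1,3}^3\left(-2c_{1,5}c_{1,1}+3c_{0,1}c_{1,3}^2\right)}{c_{1,4}^5},\qquad \frac{{c'}_{1,3}^{2}c'_{1,1}}{{c'}_{1,4}^{3}}=\frac{c_{1,3}^2c_{1,1}}{c_{1,4}^3}.$$ 2. For any $\lambda_1,\lambda_2,\lambda_3\in\mathbb{C}$ there exists $L(C)\in U_8^{31}$ with $$\frac{c_{1,3}^4\left(-9c_{0,0}c_{1,3}^4+3c_{1,5}c_{0,1}c_{1,3}^2-c_{1,5}^2c_{1,1}\right)}{c_{1,4}^7}=\lambda_1,\quad \frac{c_{1,3}^3\left(-2c_{1,5}c_{1,1}+3c_{0,1}c_{1,3}^2\right)}{c_{1,4}^5}=\lambda_2,\quad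 \frac{c_{1,3}^2c_{1,1}}{c_{1,4}^3}=\lambda_3.$$ Moreover, the orbits (isomorphism classes) in $U_8^{31}$ are parameterized by the algebras $L(\lambda_1,\lambda_2,\lambda_3,0,1,1,0,0,0,0)$, $\lambda_1,\lambda_2,\lambda_3\in\mathbb{C}$: these algebras lie in $U_8^{31}$ and every algebra in $U_8^{31}$ is isomorphic to one of them.
   Context: All algebras are over $\mathbb{C}$. For $C=(c_{0,0},c_{0,1},c_{1,1},c_{1,2},c_{1,3},c_{1,4},c_{1,5},c_{2,3},c_{2,4},c_{3,4})\in\mathbb{C}^{10}$, $L(C)$ denotes the $8$-dimensional complex algebra with basis $e_0,\dots,e_7$ and products (products of basis vectors not listed are zero): $[e_i,e_0]=e_{i+1}$ for $1\le i\le 6$; $[e_0,e_i]=-e_{i+1}$ for $2\le i\le 6$; $[e_0,e_0]=c_{0,0}e_7$; $[e_0,e_1]=-e_2+c_{0,1}e_7$; $[e_1,e_1]=c_{1,1}e_7$; $[e_1,e_2]=-[e_2,e_1]=c_{1,2}e_4+c_{1,3}e_5+c_{1,4}e_6+c_{1,5}e_7$; $[e_1,e_3]=-[e_3,e_1]=c_{1,2}e_5+c_{1,3}e_6+c_{1,4}e_7$; $[e_1,e_4]=-[e_4,e_1]=(c_{1,2}-c_{2,3})e_6+(c_{1,3}-c_{2,4})e_7$; $[e_1,e_5]=-[e_5,e_1]=(c_{1,2}-2c_{2,3})e_7$; $[e_2,e_3]=-[e_3,e_2]=c_{2,3}e_6+c_{2,4}e_7$; $[e_2,e_4]=-[e_4,e_2]=c_{2,3}e_7$;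 $[e_i,e_{7-i}]=-[e_{7-i},e_i]=(-1)^ic_{3,4}e_7$ for $1\le i\le 6$. $TLeib_8$ is the set of all $L(C)$ with $c_{3,4}(c_{2,3}+2c_{1,2})=0$ (the condition for $L(C)$ to be a Leibniz algebra, i.e. to satisfy $[x,[y,z]]=[[x,y],z]-[[x,z],y]$). The entries of $C'$ are denoted $c'_{i,j}$, in the same order. ''Isomorphic'' means isomorphic as algebras over $\mathbb{C}$; an orbit is an isomorphism class. *)

(* Defs.v *)
From HB Require Import structures.
From mathcomp Require Import all_boot all_order all_algebra.
From mathcomp Require Import reals complex.

Set Implicit Arguments.
Unset Strict Implicit.
Unset Printing Implicit Defensive.

Import Order.TTheory GRing.Theory Num.Theory.
Local Open Scope ring_scope.

(* A (nonassociative) algebra on a vector space V is given by its product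
   V -> V -> V; the products used below are bilinear by construction. *)
Definition alg_isomorphic (K : fieldType) (V W : lmodType K)
    (mV : V -> V -> V) (mW : W -> W -> W) : Prop :=
  exists f : {linear V -> W},
    bijective f /\ forall x y : V, f (mV x y) = mW (f x) (f y).

Record coeffs (K : Type) := Coeffs {
  c00 : K; c01 : K; c11 : K; c12 : K; c13 : K;
  c14 : K; c15 : K; c23 : K; c24 : K; c34 : K }.

Section Algebra.
Variable K : fieldType.
Implicit Types (C : coeffs K) (i j k : nat).

Definition e k : 'rV[K]_8 := delta_mx 0 (inord k).

(* [e_i, e_j] for 1 <= i < j <= 7. *)
Definition bracket_lt C i j : 'rV[K]_8 :=
  match i, j with
  | 1%N, 2%N => c12 C *: e 4 + c13 C *: e 5 + c14 C *: e 6 + c15 C *: e 7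
  | 1%N, 3%N => c12 C *: e 5 + c13 C *: e 6 + c14 C *: e 7
  | 1%N, 4%N => (c12 C - c23 C) *: e 6 + (c13 C - c24 C) *: e 7
  | 1%N, 5%N => (c12 C - 2 * c23 C) *: e 7
  | 1%N, 6%N => - c34 C *: e 7
  | 2%N, 3%N => c23 C *: e 6 + c24 C *: e 7
  | 2%N, 4%N => c23 C *: e 7
  | 2%N, 5%N => c34 C *: e 7
  | 3%N, 4%N => - c34 C *: e 7
  | _, _ => 0
  end.

(* [e_i, e_j] for 0 <= i, j <= 7; apart from the products listed first,
   the bracket of basis vectors is antisymmetric. *)
Definition bracket_basis C i j : 'rV[K]_8 :=
  match i, j with
  | 0%N, 0%N => c00 C *: e 7
  | 0%N, 1%N => - e 2 + c01 C *: e 7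
  | 1%N, 1%N => c11 C *: e 7
  | 0%N, 7%N | 7%N, 0%N => 0
  | 0%N, _ => - e j.+1
  | _, 0%N => e i.+1
  | _, _ => if (i < j)%N then bracket_lt C i j else - bracket_lt C j i
  end.

Definition L C (x y : 'rV[K]_8) : 'rV[K]_8 :=
  \sum_(i < 8) \sum_(j < 8) (x 0 i * y 0 j) *: bracket_basis C i j.

(* L C determines C, so sets of algebras L C are given as predicates on C. *)
Definition TLeib8 C : Prop := c34 C * (c23 C + 2 * c12 C) = 0.

Definition U831 C : Prop :=
  TLeib8 C /\
  [/\ c34 C = 0, [/\ c23 C = 0, c24 C = 0 & c12 C = 0], c13 C != 0
    & c14 C != 0].

Definition inv1 C : K :=
  c13 C ^+ 4 * (- 9 * c00 C * c13 C ^+ 4 + 3 * c15 C * c01 C * c13 C ^+ 2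
                - c15 C ^+ 2 * c11 C) / c14 C ^+ 7.

Definition inv2 C : K :=
  c13 C ^+ 3 * (- 2 * c15 C * c11 C + 3 * c01 C * c13 C ^+ 2) / c14 C ^+ 5.

Definition inv3 C : K := c13 C ^+ 2 * c11 C / c14 C ^+ 3.

End Algebra.

(* Main.v *)
Require Import Defs.
From HB Require Import structures.
From mathcomp Require Import all_boot all_order all_algebra.
From mathcomp Require Import reals complex ring.

Set Implicit Arguments.
Unset Strict Implicit.
Unset Printing Implicit Defensive.

Import Order.TTheory GRing.Theory Num.Theory.
Local Open Scope ring_scope.

(** In an algebra L C of the family, e_0 and e_1 generate: e_2, ..., e_7 are
    obtained from e_1 by repeated right multiplication by e_0. A homomorphism
    f : L C -> L C' is thus known once x = f e_0 and y = f e_1 are. Write s, u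
    for the first two entries of x and t for the entry of y at e_1.

    Necessity. The images f e_k, k >= 2, descend along the flag spanned by
    e_k, ..., e_7, with leading entry d s^(k-2), where d is the determinant of
    the (e_0, e_1)-entries of y and x ([entry_L_filtration]). Injectivity
    at e_7 makes d and s nonzero; comparing the e_3-entries of the images of
    [e_1, e_2] shows that y has no e_0-entry, so that d = t s. The remaining
    entries of the relations of [e_1, e_2], [e_0, e_0], [e_0, e_1] and
    [e_1, e_1] involve only s, t and u once the other entries of x and y have
    cancelled out, and amount to the six equations of [basis_change].

    Sufficiency. Conversely, the choice x = s e_0 + u e_1, y = t e_1 extends to
    an explicit triangular map [change], which is an isomorphism as soon as
    those six equations hold and s, t are nonzero.

    Hence the isomorphism classes are the orbits of the three-parameter
    transformations [basis_change] of the six coefficients c_00, c_01, c_11,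
    c_13, c_14, c_15. The invariants are rational functions constant on the
    orbits ([inv_basis_change]). They separate the orbits
    ([basis_change_of_inv]): s and t are determined rationally by matching c_13
    and c_14, then u by matching c_15, which it enters with coefficient
    3 c_13 c'_13 s^2; when c_13, c_14, c_15 are prescribed the invariants
    determine the three other coefficients. Everything holds over a field in
    which 3 is invertible. On the algebras L(l1, l2, l3, 0, 1, 1, 0, 0, 0, 0)
    the invariants are -9 l1, 3 l2 and l3, hence arbitrary, and so these
    algebras meet every class. *)

(** * Entries of vectors and of brackets *)

Section Classification.
Variable K : fieldType.
Implicit Types (C : coeffs K) (x y : 'rV[K]_8).

(** Natural numbers as indices let brackets be evaluated by case analysis. *)
Definition entry x k : K := x 0 (inord k).

Lemma entry_ord x (i : 'I_8) : x 0 i = entry x i.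
Proof. by rewrite /entry inord_val. Qed.

Lemma rV8P x y : (forall k, (k < 8)%N -> entry x k = entry y k) -> x = y.
Proof. by move=> eq_xy; apply/rowP => i; rewrite !entry_ord eq_xy. Qed.

Lemma entryD x y k : entry (x + y) k = entry x k + entry y k.
Proof. by rewrite /entry mxE. Qed.
Lemma entryN x k : entry (- x) k = - entry x k.
Proof. by rewrite /entry mxE. Qed.
Lemma entryZ a x k : entry (a *: x) k = a * entry x k.
Proof. by rewrite /entry mxE. Qed.
Lemma entry0 k : entry 0 k = 0.
Proof. by rewrite /entry mxE. Qed.

Lemma entry_sum n (F : 'I_n -> 'rV[K]_8) k :
  entry (\sum_(i < n) F i) k = \sum_(i < n) entry (F i) k.
Proof. by rewrite /entry summxE. Qed.

Lemma entry_e j k : (j < 8)%N -> (k < 8)%N -> entry (e K j) k = (j == k)%:R.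
Proof.
by move=> j8 k8; rewrite /entry /e mxE eqxx -val_eqE /= !inordK // eq_sym.
Qed.

Definition minor x y i j := entry x i * entry y j - entry x j * entry y i.

Definition bracket_entry C x y k : K :=
  match k with
  | 2 => minor x y 1 0
  | 3 => minor x y 2 0
  | 4 => minor x y 3 0
  | 5 => minor x y 4 0 + c13 C * minor x y 1 2
  | 6 => minor x y 5 0 + c13 C * minor x y 1 3 + c14 C * minor x y 1 2
  | 7 => minor x y 6 0 + c13 C * minor x y 1 4 + c14 C * minor x y 1 3
         + c15 C * minor x y 1 2
         + c00 C * entry x 0 * entry y 0 + c01 C * entry x 0 * entry y 1
         + c11 C * entry x 1 * entry y 1
  | _ => 0
  end.

(** The product of x and y in closed form: apart from the three terms with
    c_00, c_01 and c_11 it is an alternating form, whence the minors. *)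
Lemma entry_L C x y k : U831 C -> (k < 8)%N ->
  entry (L C x y) k = bracket_entry C x y k.
Proof.
case=> _ [c34_0 [c23_0 c24_0 c12_0] _ _] k8.
have -> : entry (L C x y) k = \sum_(0 <= i < 8) \sum_(0 <= j < 8)
    (entry x i * entry y j) * entry (bracket_basis C i j) k.
  rewrite /L entry_sum big_mkord; apply: eq_bigr => i _.
  rewrite entry_sum big_mkord; apply: eq_bigr => j _.
  by rewrite entryZ !entry_ord.
rewrite !big_nat_recr //= !big_nil.
rewrite c34_0 c23_0 c24_0 c12_0.
rewrite !(entryD, entryN, entryZ, entry0) !entry_e //.
case: k k8 => [|[|[|[|[|[|[|[|//]]]]]]]] _; rewrite /bracket_entry /minor /=; ring.
Qed.

(** * The six equations between isomorphic algebras *)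

(** The equations that make x = s e_0 + u e_1 and y = t e_1 in L C' satisfy the
    relations of e_0 and e_1 in L C, after division by powers of the nonzero
    scalars s and t: in the first line those of [e_1, e_2], in the second one
    those of [e_1, e_1], of [e_0, e_1] + [e_1, e_0] and of [e_0, e_0]. *)
Definition basis_change C C' (s t u : K) : Prop :=
  [/\ c13 C' * t = c13 C * s ^+ 3,
      c14 C' * t = c14 C * s ^+ 4
    & c15 C' * t = c15 C * s ^+ 5 - 3 * c13 C * c13 C' * s ^+ 2 * u] /\
  [/\ c11 C' * t = c11 C * s ^+ 6,
      c01 C' * s + 2 * c11 C' * u = c01 C * s ^+ 6
    & c00 C' * s ^+ 2 + c01 C' * s * u + c11 C' * u ^+ 2 = c00 C * t * s ^+ 6].

(** Given L C' and (s, t, u), the equations determine L C. *)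
Lemma basis_change_solve C C' s t u : s != 0 -> t != 0 ->
  basis_change C C' s t u ->
  [/\ c13 C = c13 C' * t / s ^+ 3,
      c14 C = c14 C' * t / s ^+ 4
    & c15 C = (c15 C' * t + 3 * c13 C * c13 C' * s ^+ 2 * u) / s ^+ 5] /\
  [/\ c11 C = c11 C' * t / s ^+ 6,
      c01 C = (c01 C' * s + 2 * c11 C' * u) / s ^+ 6
    & c00 C = (c00 C' * s ^+ 2 + c01 C' * s * u + c11 C' * u ^+ 2)
              / (t * s ^+ 6)].
Proof.
move=> s0 t0 [[-> -> ->] [-> -> ->]].
by split; split; field; rewrite ?s0 ?t0.
Qed.

(* Proves a linear relation between products of basis vectors of L C. *)
Ltac by_entries UC :=
  let k := fresh in let k8 := fresh in
  apply: rV8P => k k8; rewrite ?(entryD, entryZ) ?(entry_L _ _ UC) //;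
  case: k k8 => [|[|[|[|[|[|[|[|//]]]]]]]] _;
  rewrite /bracket_entry /minor ?entry_e //=; ring.

(** Reduces an equation implied linearly by another one to a ring identity. *)
Lemma eq_of_diff (a b a' b' : K) : a' = b' -> a - b = a' - b' -> a = b.
Proof. by move=> -> /eqP; rewrite subrr subr_eq0 => /eqP. Qed.

(* Replaces by 0 those of the first six entries of a vector that v0 shows to
   vanish. *)
Ltac clear_low v0 :=
  try rewrite (v0 0%N isT); try rewrite (v0 1%N isT);
  try rewrite (v0 2%N isT); try rewrite (v0 3%N isT);
  try rewrite (v0 4%N isT); try rewrite (v0 5%N isT).

(** Right multiplication by x shifts the flag of the spans of e_i, ..., e_7 by
    one index, and multiplies the leading entry by the e_0-entry of x. Indeed
    the e_0- and e_1-entries of v vanish, so that the terms with c_13, c_14 and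
    c_15 only come from the e_1-entry of x, and these raise the index by at
    least three. *)
Lemma entry_L_filtration C v x i : U831 C -> (1 < i)%N -> (i < 7)%N ->
  (forall j, (j < i)%N -> entry v j = 0) ->
  (forall j, (j < i.+1)%N -> entry (L C v x) j = 0) /\
  entry (L C v x) i.+1 = entry v i * entry x 0.
Proof.
move=> UC i1 i7 v0.
split=> [j ji|]; last rewrite entry_L //.
  rewrite entry_L //; last exact: leq_trans ji (leqW i7).
  case: i i1 i7 v0 ji => [|[|[|[|[|[|[|//]]]]]]] //= _ _ v0;
  case: j => [|[|[|[|[|[|[|//]]]]]]] //= _;
  rewrite /minor; clear_low v0; ring.
case: i i1 i7 v0 => [|[|[|[|[|[|[|//]]]]]]] //= _ _ v0;
  rewrite /minor; clear_low v0; ring.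
Qed.

(** The parameters s, u are the first two entries of f e_0 and t is the
    e_1-entry of f e_1; the e_2- and e_3-entries of f e_1, which also occur in
    the relation of [e_1, e_2], cancel out. *)
Lemma alg_isomorphic_basis_change C C' : U831 C -> U831 C' ->
  alg_isomorphic (L C) (L C') ->
  exists s t u, [/\ s != 0, t != 0 & basis_change C C' s t u].
Proof.
move=> UC UC' [f [f_bij fL]].
pose x := f (e K 0); pose y := f (e K 1); pose z i := f (e K i).
have zS i : (0 < i < 7)%N -> z i.+1 = L C' (z i) x.
  move=> i17; rewrite /z /x -fL; congr (f _).
  by case: i i17 => [|[|[|[|[|[|[|//]]]]]]] // _; by_entries UC.
have E00 : L C' x x = c00 C *: z 7.
  by rewrite /z /x -fL -linearZ; congr (f _); by_entries UC.
have E01 : L C' x y + L C' y x = c01 C *: z 7.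
  by rewrite /z /x /y -!fL -linearD -linearZ; congr (f _); by_entries UC.
have E11 : L C' y y = c11 C *: z 7.
  by rewrite /z /y -fL -linearZ; congr (f _); by_entries UC.
have E12 : L C' y (z 2) = c13 C *: z 5 + c14 C *: z 6 + c15 C *: z 7.
  by rewrite /z /y -fL -!linearZ -!linearD; congr (f _); by_entries UC.
have zSk i k : (0 < i < 7)%N -> (k < 8)%N ->
    entry (z i.+1) k = bracket_entry C' (z i) x k.
  by move=> i17 k8; rewrite zS // entry_L.
pose d := entry y 1 * entry x 0 - entry x 1 * entry y 0.
have z2_low : [/\ entry (z 2) 0 = 0, entry (z 2) 1 = 0 & entry (z 2) 2 = d].
  by rewrite !zSk //= /minor; split=> //; rewrite /d; ring.
have z_low i : (i < 6)%N -> (forall j, (j < i.+2)%N -> entry (z i.+2) j = 0) /\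
    entry (z i.+2) i.+2 = d * entry x 0 ^+ i.
  elim: i => [_|i IHi i6].
    case: z2_low => z20 z21 ->; split; last by rewrite mulr1.
    by case=> [|[|//]].
  have [low lead] := IHi (ltnW i6).
  have [low' lead'] := entry_L_filtration x UC' (isT : 1 < i.+2)%N i6 low.
  by rewrite zS ?ltnS ?(ltnW i6) //; split=> //; rewrite lead' lead exprSr mulrA.
have z7E k : (k < 8)%N -> entry (z 7) k = d * entry x 0 ^+ 5 * (k == 7)%:R.
  have [low lead] := z_low 5 isT.
  rewrite ltnS leq_eqVlt => /orP[/eqP->|k7]; first by rewrite lead mulr1.
  by rewrite low // ltn_eqF ?mulr0.
have /andP[d0 s0] : (d != 0) && (entry x 0 != 0).
  rewrite -negb_or; apply/negP => ds0.
  have z7_0 : z 7 = 0.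
    apply: rV8P => k k8; rewrite z7E // entry0.
    by case/orP: ds0 => /eqP ->; rewrite ?expr0n /= !(mul0r, mulr0).
  have /(congr1 (fun v => entry v 7)) : e K 7 = 0.
    by apply: (bij_inj f_bij); rewrite linear0.
  by rewrite entry_e // entry0; apply/eqP; rewrite oner_eq0.
have [z20 z21 z22] := z2_low.
have E12k k : (k < 8)%N -> bracket_entry C' y (z 2) k =
    c13 C * entry (z 5) k + c14 C * entry (z 6) k + c15 C * entry (z 7) k.
  by move=> k8; rewrite -entry_L // E12 !entryD !entryZ.
(* The product [e_1, e_2] of L C has no e_3 or e_4 term, whereas that of y and
   z 2 starts with the e_3-entry - d * entry y 0. *)
have y0 : entry y 0 = 0.
  have := E12k 3 isT.
  rewrite (z_low 3 isT).1 // (z_low 4 isT).1 // (z_low 5 isT).1 //=.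
  rewrite /minor z20 z22 !mulr0 !addr0 sub0r => /eqP.
  by rewrite oppr_eq0 mulf_eq0 (negPf d0) orbF => /eqP.
have dE : d = entry y 1 * entry x 0 by rewrite /d y0; ring.
have t0 : entry y 1 != 0 by move: d0; rewrite dE mulf_eq0 => /norP[].
exists (entry x 0), (entry y 1), (entry x 1); split=> //.
(* The entries of the z i that the relation of [e_1, e_2] involves beyond the
   leading ones. *)
have low3 := (z_low 1 isT).1; have low4 := (z_low 2 isT).1.
have z23 : entry (z 2) 3 = entry y 2 * entry x 0.
  by rewrite zSk //= /minor y0; ring.
have z24 : entry (z 2) 4 = entry y 3 * entry x 0.
  by rewrite zSk //= /minor y0; ring.
have z35 : entry (z 3) 5 =
    entry y 3 * entry x 0 ^+ 2 - c13 C' * d * entry x 1.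
  by rewrite zSk //= /minor z24 z20 z21 z22; ring.
have z45 : entry (z 4) 5 = entry y 2 * entry x 0 ^+ 3.
  rewrite zSk //= /minor zSk //= /minor z23 z20.
  by rewrite (low3 0) // (low3 1) // (low3 2) //; ring.
have z46 : entry (z 4) 6 =
    entry y 3 * entry x 0 ^+ 3 - 2 * c13 C' * d * entry x 0 * entry x 1.
  rewrite zSk //= /minor z35 (low3 0) // (low3 1) // (low3 2) //.
  by rewrite (z_low 1 isT).2; ring.
have z56 : entry (z 5) 6 = entry y 2 * entry x 0 ^+ 4.
  by rewrite zSk //= /minor z45 !low4 //; ring.
have z57 : entry (z 5) 7 =
    entry y 3 * entry x 0 ^+ 4 - 3 * c13 C' * d * entry x 0 ^+ 2 * entry x 1.
  rewrite zSk //= /minor z46 (low4 0) // (low4 1) // (low4 2) // (low4 3) //.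
  by rewrite (z_low 2 isT).2; ring.
have z67 : entry (z 6) 7 = entry y 2 * entry x 0 ^+ 5.
  by rewrite zSk //= /minor z56 !(z_low 3 isT).1 //; ring.
have cancel_d a b : a * d = b * d -> a = b by apply: mulIf.
have F13 : c13 C' * entry y 1 = c13 C * entry x 0 ^+ 3.
  apply: cancel_d; have := E12k 5 isT.
  rewrite (z_low 3 isT).2 (z_low 4 isT).1 // (z_low 5 isT).1 //=.
  rewrite /minor z20 z21 z22 y0 => F.
  by apply: (eq_of_diff F); ring.
have F14 : c14 C' * entry y 1 = c14 C * entry x 0 ^+ 4.
  apply: cancel_d; have := E12k 6 isT.
  rewrite z56 (z_low 4 isT).2 (z_low 5 isT).1 //=.
  rewrite /minor z20 z21 z22 y0 z23 => F.
  have {}F13 := congr1 (fun a => a * entry y 2 * entry x 0) F13.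
  by apply: (eq_of_diff (congr2 +%R F (esym F13))); ring.
have F15 : c15 C' * entry y 1 =
    c15 C * entry x 0 ^+ 5 - 3 * c13 C * c13 C' * entry x 0 ^+ 2 * entry x 1.
  apply: cancel_d; have := E12k 7 isT.
  rewrite z57 z67 (z_low 5 isT).2 //=.
  rewrite /minor z20 z21 z22 y0 z23 z24 => F.
  have {}F13 := congr1 (fun a => a * entry y 3 * entry x 0) F13.
  have {}F14 := congr1 (fun a => a * entry y 2 * entry x 0) F14.
  by apply: (eq_of_diff (congr2 +%R F (congr2 +%R (esym F13) (esym F14)))); ring.
split; split=> //.
- have := congr1 (fun v => entry v 7) E11.
  rewrite entry_L // entryZ z7E //= /minor y0 dE => F.
  by apply: (mulIf t0); apply: (eq_of_diff F); ring.
- have := congr1 (fun v => entry v 7) E01.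
  rewrite entryD !entry_L // entryZ z7E //= /minor y0 dE => F.
  by apply: (mulIf t0); apply: (eq_of_diff F); ring.
have := congr1 (fun v => entry v 7) E00.
rewrite entry_L // entryZ z7E //= /minor dE => F.
by apply: (eq_of_diff F); ring.
Qed.

(** * The isomorphism attached to a solution of the equations *)

Lemma injective_linear_bij n (f : {linear 'rV[K]_n -> 'rV[K]_n}) :
  (forall x : 'rV[K]_n, f x = 0 -> x = 0) -> bijective f.
Proof.
move=> f_inj; have uM : lin1_mx f \in unitmx.
  rewrite -row_free_unit; apply: inj_row_free => v.
  by rewrite mul_rV_lin1; apply: f_inj.
exists (mulmxr (invmx (lin1_mx f))) => v /=.
  by rewrite -mul_rV_lin1 mulmxK.
by rewrite -mul_rV_lin1 mulmxKV.
Qed.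

(** The k-th entry of the image of x under the linear map that sends e_0 to
    s e_0 + u e_1, e_1 to t e_1, and e_(i+1) to the product in L C' of the
    images of e_i and e_0, for i > 0. *)
Definition change_entry C' s t u x k : K :=
  match k with
  | 0 => s * entry x 0
  | 1 => u * entry x 0 + t * entry x 1
  | 2 => t * s * entry x 2
  | 3 => t * s ^+ 2 * entry x 3
  | 4 => t * s ^+ 3 * entry x 4
  | 5 => t * s ^+ 4 * entry x 5 - c13 C' * t * s * u * entry x 3
  | 6 => t * s ^+ 5 * entry x 6 - 2 * c13 C' * t * s ^+ 2 * u * entry x 4
         - c14 C' * t * s * u * entry x 3
  | 7 => t * s ^+ 6 * entry x 7 - 3 * c13 C' * t * s ^+ 3 * u * entry x 5
         - 2 * c14 C' * t * s ^+ 2 * u * entry x 4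
         - c15 C' * t * s * u * entry x 3 + c11 C' * t * u * entry x 2
  | _ => 0
  end.

Definition change C' s t u x : 'rV[K]_8 := \row_k change_entry C' s t u x k.

Lemma entry_change C' s t u x k : (k < 8)%N ->
  entry (change C' s t u x) k = change_entry C' s t u x k.
Proof. by move=> k8; rewrite {1}/entry mxE inordK. Qed.

Fact change_is_linear C' s t u : linear (change C' s t u).
Proof.
move=> a x y; apply: rV8P => k k8.
rewrite entryD entryZ !entry_change // /change_entry !entryD !entryZ.
case: k k8 => [|[|[|[|[|[|[|[|//]]]]]]]] _; ring.
Qed.

HB.instance Definition _ C' s t u :=
  GRing.isLinear.Build K 'rV[K]_8 'rV[K]_8 _ (change C' s t u)
    (change_is_linear C' s t u).

Lemma change_bij C' s t u : s != 0 -> t != 0 -> bijective (change C' s t u).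
Proof.
move=> s0 t0; apply: injective_linear_bij => x x0.
have xk k : (k < 8)%N -> change_entry C' s t u x k = 0.
  by move=> k8; rewrite -entry_change // x0 entry0.
have pivot m a : t * s ^+ m * a = 0 -> a = 0.
  by move/eqP; rewrite !mulf_eq0 expf_eq0 (negPf s0) (negPf t0) andbF => /eqP.
have h0 : entry x 0 = 0.
  by move/eqP: (xk 0 isT); rewrite mulf_eq0 (negPf s0) => /eqP.
have h1 : entry x 1 = 0.
  by apply: (pivot 0); rewrite -[RHS](xk 1 isT) /= h0; ring.
have h2 : entry x 2 = 0.
  by apply: (pivot 1); rewrite -[RHS](xk 2 isT) /=; ring.
have h3 := pivot 2 _ (xk 3 isT); have h4 := pivot 3 _ (xk 4 isT).
have h5 : entry x 5 = 0.
  by apply: (pivot 4); rewrite -[RHS](xk 5 isT) /= h3; ring.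
have h6 : entry x 6 = 0.
  by apply: (pivot 5); rewrite -[RHS](xk 6 isT) /= h3 h4; ring.
have h7 : entry x 7 = 0.
  by apply: (pivot 6); rewrite -[RHS](xk 7 isT) /= h2 h3 h4 h5; ring.
apply: rV8P => k k8; rewrite entry0.
by case: k k8 => [|[|[|[|[|[|[|[|//]]]]]]]].
Qed.

Lemma change_morph C C' s t u x y : U831 C -> U831 C' ->
  s != 0 -> t != 0 -> basis_change C C' s t u ->
  change C' s t u (L C x y) = L C' (change C' s t u x) (change C' s t u y).
Proof.
move=> UC UC' s0 t0 stu.
apply: rV8P => k k8; rewrite entry_change // entry_L //.
have chk j : (j < 8)%N -> entry (change C' s t u x) j = change_entry C' s t u x j.
  exact: entry_change.
have chk' j : (j < 8)%N -> entry (change C' s t u y) j = change_entry C' s t u y j.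
  exact: entry_change.
rewrite /bracket_entry /minor !chk // !chk' //.
rewrite /change_entry !entry_L // /bracket_entry /minor.
have [[E13 E14 E15] [E11 E01 E00]] := basis_change_solve s0 t0 stu.
rewrite E15 E13 E14 E11 E01 E00.
case: k k8 => [|[|[|[|[|[|[|[|//]]]]]]]] _ /=;
  field; rewrite ?s0 ?t0 //.
Qed.

(** * Invariants and normal forms *)

Lemma inv_basis_change C C' s t u : U831 C' -> s != 0 -> t != 0 ->
  basis_change C C' s t u ->
  [/\ inv1 C' = inv1 C, inv2 C' = inv2 C & inv3 C' = inv3 C].
Proof.
move=> [_ [_ _ p0 q0]] s0 t0.
move=> /(basis_change_solve s0 t0)[[E13 E14 E15] [E11 E01 E00]].
rewrite /inv1 /inv2 /inv3 E15 E13 E14 E11 E01 E00.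
by split; field; rewrite ?p0 ?q0 ?s0 ?t0.
Qed.

Lemma nine_neq0 : (3 : K) != 0 -> (9 : K) != 0.
Proof. by move=> n3; rewrite (natrM K 3 3) mulf_neq0. Qed.

(** Once c_13, c_14 and c_15 are known, the invariants determine c_11, then
    c_01, then c_00; so it suffices to match the first three, which fixes s, t
    and u. *)
Lemma basis_change_of_inv C C' : (3 : K) != 0 -> U831 C -> U831 C' ->
  [/\ inv1 C' = inv1 C, inv2 C' = inv2 C & inv3 C' = inv3 C] ->
  exists s t u, [/\ s != 0, t != 0 & basis_change C C' s t u].
Proof.
move=> n3 [_ [_ _ P0 Q0]] [_ [_ _ p0 q0]].
have n9 := nine_neq0 n3.
have c11E (D : coeffs K) : c13 D != 0 -> c14 D != 0 ->
    c11 D = inv3 D * c14 D ^+ 3 / c13 D ^+ 2.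
  by move=> pD qD; rewrite /inv3; field; rewrite pD qD.
have c01E (D : coeffs K) : c13 D != 0 -> c14 D != 0 ->
    c01 D = (inv2 D * c14 D ^+ 5 / c13 D ^+ 3 + 2 * c15 D * c11 D)
            / (3 * c13 D ^+ 2).
  by move=> pD qD; rewrite /inv2; field; rewrite n3 pD qD.
have c00E (D : coeffs K) : c13 D != 0 -> c14 D != 0 ->
    c00 D = (3 * c15 D * c01 D * c13 D ^+ 2 - c15 D ^+ 2 * c11 D
             - inv1 D * c14 D ^+ 7 / c13 D ^+ 4) / (9 * c13 D ^+ 4).
  by move=> pD qD; rewrite /inv1; field; rewrite n9 pD qD.
move=> [I1 I2 I3].
(* The quotient of the equations for c_14 and c_13 gives s, then that for c_13
   gives t, and that for c_15 gives u. *)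
pose s := c14 C' * c13 C / (c13 C' * c14 C).
pose t := c13 C * s ^+ 3 / c13 C'.
pose u := (c15 C * s ^+ 5 - c15 C' * t) / (3 * c13 C * c13 C' * s ^+ 2).
have s0 : s != 0.
  by rewrite /s mulf_neq0 ?invr_eq0 ?mulf_neq0.
have t0 : t != 0.
  by rewrite /t mulf_neq0 ?invr_eq0 // mulf_neq0 // expf_neq0.
exists s, t, u; split=> //.
rewrite /basis_change (c00E C) // (c00E C') // (c01E C) // (c01E C') //.
rewrite (c11E C) // (c11E C') // I1 I2 I3 /u /t /s.
by split; split; field; rewrite ?n3 ?n9 ?P0 ?Q0 ?p0 ?q0.
Qed.

(** * The classification *)

Lemma alg_isomorphic_inv C C' : (3 : K) != 0 -> U831 C -> U831 C' ->
  alg_isomorphic (L C) (L C') <->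
  [/\ inv1 C' = inv1 C, inv2 C' = inv2 C & inv3 C' = inv3 C].
Proof.
move=> n3 UC UC'; split.
  case/(alg_isomorphic_basis_change UC UC') => s [t [u [s0 t0 stu]]].
  exact: inv_basis_change stu.
case/(basis_change_of_inv n3 UC UC') => s [t [u [s0 t0 stu]]].
exists (change C' s t u); split; first exact: change_bij.
by move=> x y; apply: change_morph.
Qed.

Definition normal_form (l1 l2 l3 : K) := Coeffs l1 l2 l3 0 1 1 0 0 0 0.

Lemma U831_normal_form l1 l2 l3 : U831 (normal_form l1 l2 l3).
Proof. by split; [rewrite /TLeib8 /= mul0r | split=> //=; rewrite oner_eq0]. Qed.

Lemma inv_normal_form l1 l2 l3 :
  [/\ inv1 (normal_form l1 l2 l3) = - 9 * l1,
      inv2 (normal_form l1 l2 l3) = 3 * l2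
    & inv3 (normal_form l1 l2 l3) = l3].
Proof.
by split; rewrite /inv1 /inv2 /inv3 /= !expr1n ?expr0n /= divr1; ring.
Qed.

Lemma normal_form_of_inv m1 m2 m3 : (3 : K) != 0 ->
  exists l1 l2 l3, [/\ inv1 (normal_form l1 l2 l3) = m1,
    inv2 (normal_form l1 l2 l3) = m2 & inv3 (normal_form l1 l2 l3) = m3].
Proof.
move=> n3; exists (- m1 / 9), (m2 / 3), m3.
have n9 := nine_neq0 n3.
by have [-> -> ->] := inv_normal_form (- m1 / 9) (m2 / 3) m3; split=> //; field.
Qed.

End Classification.

Theorem proposition2p34 (R : realType) :
  (forall C C' : coeffs R[i], U831 C -> U831 C' ->
     (alg_isomorphic (L C) (L C') <->
      [/\ inv1 C' = inv1 C, inv2 C' = inv2 C & inv3 C' = inv3 C])) /\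
  (forall l1 l2 l3 : R[i], exists C : coeffs R[i],
     U831 C /\ [/\ inv1 C = l1, inv2 C = l2 & inv3 C = l3]) /\
  (forall l1 l2 l3 : R[i], U831 (Coeffs l1 l2 l3 0 1 1 0 0 0 0)) /\
  (forall C : coeffs R[i], U831 C ->
     exists l1 l2 l3 : R[i],
       alg_isomorphic (L C) (L (Coeffs l1 l2 l3 0 1 1 0 0 0 0))).
Proof.
have n3 : (3 : R[i]) != 0 by rewrite pnatr_eq0.
split=> [C C'|]; first exact: alg_isomorphic_inv.
split=> [m1 m2 m3|].
  have [l1 [l2 [l3 invE]]] := normal_form_of_inv m1 m2 m3 n3.
  by exists (normal_form l1 l2 l3); split=> //; apply: U831_normal_form.
split=> [l1 l2 l3|C UC]; first exact: U831_normal_form.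
have [l1 [l2 [l3 invE]]] := normal_form_of_inv (inv1 C) (inv2 C) (inv3 C) n3.
exists l1, l2, l3; apply/(alg_isomorphic_inv n3 UC) => //.
exact: U831_normal_form.
Qed.
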